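(* Let $\mathbb{H}\in\mathbb{R}_+^{n_R\times n_T}$ be a nonzero matrix whose channel graph is strongly connected, and let $\boldsymbol{\alpha}\in[0,1]^{n_T}$ with $\alpha_1\ge\alpha_2\ge\cdots\ge\alpha_{n_T}$. Let $g_{ij}$ be the entries of $\mathbb{G}=\mathbb{H}^{\mathsf T}\mathbb{H}$ and consider the problem of minimizing $$f_0(\mathbf{x})=-\sum_{i=1}^{n_T}\sum_{j=1}^{n_T}g_{ij}\big(\min\{x_i,x_j\}-x_ix_j\big)$$ over $\mathbf{x}\in\mathbb{R}^{n_T}$ with $0\le x_k\le\alpha_k$ for all $k$. Then an optimal solution $\mathbf{x}^\star$ is $\mathbf{x}^\star=\frac12\mathbf{1}$ if $\alpha_{n_T}\ge\frac12$, and otherwise satisfies $\mathbf{x}^\star\in\big[\alpha_{n_T},\min\{\alpha_1,\tfrac12\}\big]^{n_T}$. (This holds for every optimal solution.)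
   Context: The channel graph of $\mathbb{H}$ (columns $\mathbf{h}_1,\dots,\mathbf{h}_{n_T}$) is the directed graph with vertices $P_1,\dots,P_{n_T}$ and an edge $(P_i,P_j)$ whenever $\mathbf{h}_i^{\mathsf T}\mathbf{h}_j\ne0$; it is strongly connected if there is no nonempty proper subset $\mathcal{U}\subsetneq\{1,\dots,n_T\}$ with $\mathbf{h}_i^{\mathsf T}\mathbf{h}_j=0$ for all $i\notin\mathcal{U}$, $j\in\mathcal{U}$. $\mathbf{1}$ is the all-ones vector. ($-f_0(\mathbf{x})$ is the maximum trace of the covariance matrix of $\mathbb{H}\mathbf{X}$ over random vectors $\mathbf{X}\in[0,1]^{n_T}$ with mean $\mathbf{x}$.) *)

(* Defs.v *)
From mathcomp Require Import all_boot all_order all_algebra.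
From mathcomp Require Import reals.

Set Implicit Arguments.
Unset Strict Implicit.
Unset Printing Implicit Defensive.

Import Order.TTheory GRing.Theory Num.Theory.
Local Open Scope ring_scope.

Definition channel_edge (R : realType) (nR nT : nat) (H : 'M[R]_(nR, nT)) :
    rel 'I_nT :=
  fun i j => ((col i H)^T *m col j H) 0 0 != 0.

(* Strong connectedness of the directed graph e, stated through cuts: no edge
   leads from outside U into U. *)
Definition strongly_connected (nT : nat) (e : rel 'I_nT) : Prop :=
  ~ exists U : {set 'I_nT},
      [/\ U != set0, U \proper [set: 'I_nT] &
          forall i j, i \notin U -> j \in U -> ~~ e i j].

Definition gram (R : realType) (nR nT : nat) (H : 'M[R]_(nR, nT)) : 'M[R]_nT :=
  H^T *m H.

Definition f0 (R : realType) (nR nT : nat) (H : 'M[R]_(nR, nT))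
    (x : 'cV[R]_nT) : R :=
  - \sum_(i < nT) \sum_(j < nT)
      gram H i j * (Num.min (x i 0) (x j 0) - x i 0 * x j 0).

Definition feasible (R : realType) (nT : nat) (alpha x : 'cV[R]_nT) : Prop :=
  forall k, 0 <= x k 0 <= alpha k 0.

Definition optimal (R : realType) (nR nT : nat) (H : 'M[R]_(nR, nT))
    (alpha x : 'cV[R]_nT) : Prop :=
  feasible alpha x /\ forall y, feasible alpha y -> f0 H x <= f0 H y.

(* Main.v *)
(* Existence is the extreme value theorem on the compact box of feasible points.
   For the location of the optima, write phi(a, b) = min(a, b) - a b, which is
   a (1 - b) for a <= b.  Truncating x from above at 1/2 decreases no
   phi(x_i, x_j), nor does then truncating it from below at any
   m <= min(1/2, alpha_{n_T}); both keep x feasible.  Whenever a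
   coordinate x_k is actually moved, the diagonal term x_k (1 - x_k) strictly
   increases, and its weight g_kk is positive because strong connectedness
   forbids zero columns. *)
Require Import Defs.
From mathcomp Require Import boolp classical_sets topology normedtype derive.
From mathcomp Require Import all_boot all_order all_algebra.
From mathcomp Require Import reals.
From mathcomp Require Import lra.

Set Implicit Arguments.
Unset Strict Implicit.
Unset Printing Implicit Defensive.

Import Order.TTheory GRing.Theory Num.Theory.
Import numFieldNormedType.Exports.
Local Open Scope ring_scope.

Lemma gramE (R : realType) (nR nT : nat) (H : 'M[R]_(nR, nT)) i j :
  gram H i j = \sum_k H k i * H k j.
Proof. by rewrite mxE; apply: eq_bigr => k _; rewrite mxE. Qed.

Lemma gram_ge0 (R : realType) (nR nT : nat) (H : 'M[R]_(nR, nT)) i j :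
  (forall i j, 0 <= H i j) -> 0 <= gram H i j.
Proof. by move=> H_ge0; rewrite gramE sumr_ge0// => k _; rewrite mulr_ge0. Qed.

(** The diagonal entry is the squared Euclidean norm of column [j]. *)
Lemma gram_diag_gt0 (R : realType) (nR nT : nat) (H : 'M[R]_(nR, nT)) j :
  col j H != 0 -> 0 < gram H j j.
Proof.
move=> Hj; have sq_ge0 k : 0 <= H k j * H k j by rewrite -expr2 sqr_ge0.
rewrite gramE lt_def sumr_ge0// andbT; apply: contra Hj.
move=> /eqP/psumr_eq0P sum0; apply/eqP/colP => k; rewrite !mxE.
by have /eqP := sum0 (fun k _ => sq_ge0 k) k isT; rewrite mulf_eq0 orbb => /eqP.
Qed.

(* If column j vanishes, the cut U = {j} has no incoming edge. *)
Lemma strongly_connected_col_neq0 (R : realType) (nR nT : nat)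
    (H : 'M[R]_(nR, nT)) j :
  H != 0 -> strongly_connected (channel_edge H) -> col j H != 0.
Proof.
move=> H_neq0 H_conn; apply/eqP => Hj0; apply: H_conn.
exists [set j]; split=> [||i k _ /set1P ->].
- by apply/set0Pn; exists j; rewrite inE.
(* Were [[set j]] everything, the zero column would be the only one, against [H != 0]. *)
- rewrite properE subsetT/=; apply: contra H_neq0 => /subsetP jT.
  apply/eqP/matrixP => i k; have /set1P -> := jT k (in_setT k).
  by move/colP: Hj0 => /(_ i); rewrite !mxE.
- by rewrite /channel_edge Hj0 mulmx0 mxE eqxx.
Qed.

(** Nonnegative weights make every term compare weakly, so one strict gain at the term [(k, k)],
    where the minimum collapses, decides. *)
Lemma f0_lt (R : realType) (nR nT : nat) (H : 'M[R]_(nR, nT))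
    (x y : 'cV[R]_nT) k :
  (forall i j, 0 <= gram H i j) -> 0 < gram H k k ->
  (forall i j, Num.min (x i 0) (x j 0) - x i 0 * x j 0 <=
               Num.min (y i 0) (y j 0) - y i 0 * y j 0) ->
  x k 0 * (1 - x k 0) < y k 0 * (1 - y k 0) ->
  f0 H y < f0 H x.
Proof.
move=> G_ge0 Gk_gt0 le_xy lt_xyk; rewrite /f0 ltrN2.
rewrite (bigD1 k)//= [ltRHS](bigD1 k)//= ltr_leD//; last first.
  by apply: ler_sum => i _; apply: ler_sum => j _; rewrite ler_wpM2l.
rewrite (bigD1 k)//= [ltRHS](bigD1 k)//= ltr_leD//; last first.
  by apply: ler_sum => j _; rewrite ler_wpM2l.
by rewrite ltr_pM2l// !minxx; lra.
Qed.

Lemma le_cov_min_half (R : realFieldType) (a b : R) : 0 <= a -> 0 <= b ->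
  Num.min a b - a * b <=
  Num.min (Num.min a 2^-1) (Num.min b 2^-1) -
    Num.min a 2^-1 * Num.min b 2^-1.
Proof.
wlog le_ab : a b / a <= b => [hw a0 b0|a0 b0].
  case/orP: (le_total a b) => /hw; first exact.
  rewrite minC (mulrC b) => /(_ b0 a0) /le_trans; apply.
  by rewrite minC (mulrC (Num.min b _)).
rewrite (min_l le_ab) (min_l (le_min2 le_ab (lexx _))).
(* If only [b] is cut, [1 - b] grows and [0 <= a]; if both are cut, the new value is 1/4, the
   maximum of [t * (1 - t)]. *)
by case: (leP a) => ?; case: (leP b) => ?; nra.
Qed.

Lemma le_cov_max (R : realFieldType) (m a b : R) :
  m <= 2^-1 -> a <= 2^-1 -> b <= 2^-1 ->
  Num.min a b - a * b <=
  Num.min (Num.max a m) (Num.max b m) - Num.max a m * Num.max b m.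
Proof.
wlog le_ab : a b / a <= b => [hw m2 a2 b2|m2 a2 b2].
  case/orP: (le_total a b) => /hw; first exact.
  rewrite minC (mulrC b) => /(_ m2 b2 a2) /le_trans; apply.
  by rewrite minC (mulrC (Num.max b _)).
rewrite (min_l le_ab) (min_l (le_max2 le_ab (lexx _))).
(* If only [a] is raised, the factor [1 - b] is positive; if both are, [a * (1 - b) <= b * (1 - b)
   <= m * (1 - m)], since [t * (1 - t)] increases up to 1/2. *)
by case: (leP a) => ?; case: (leP b) => ?; nra.
Qed.

Lemma continuous_sum (R : realType) (T : topologicalType) n
    (F : 'I_n -> T -> R) :
  (forall i, continuous (F i)) -> continuous (fun x => \sum_(i < n) F i x).
Proof.
by move=> F_cont; apply: continuous_big => // x; exact: add_continuous.
Qed.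

(** The transpose carries [f0] to row vectors, where compactness of the box and the extreme value
    theorem are applied. *)
Lemma continuous_f0_tr (R : realType) (nR nT : nat) (H : 'M[R]_(nR, nT)) :
  continuous (fun v : 'rV[R]_nT => f0 H v^T).
Proof.
have coord i : continuous (fun u : 'rV[R]_nT => u^T i 0).
  rewrite (_ : (fun _ => _) = (fun u : 'rV[R]_nT => u 0 i)).
    exact: coord_continuous.
  by apply/funext => u; rewrite mxE.
have sum_cont : continuous (fun u : 'rV[R]_nT => \sum_(i < nT) \sum_(j < nT)
    gram H i j * (Num.min (u^T i 0) (u^T j 0) - u^T i 0 * u^T j 0)).
  apply: continuous_sum => i; apply: continuous_sum => j v.
  have min_cont := continuous_min (coord i v) (coord j v).
  have mul_cont := continuousM (coord i v) (coord j v).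
  have cst_cont : {for v, continuous (fun _ : 'rV[R]_nT => gram H i j)}.
    exact: cst_continuous.
  exact: (continuousM cst_cont (continuousB min_cont mul_cont)).
by move=> v; exact: (continuousN (sum_cont v)).
Qed.

Section Optimal.
Variables (R : realType) (nR nT : nat) (H : 'M[R]_(nR, nT)).
Variable alpha : 'cV[R]_nT.

Lemma optimal_exists : (forall k, 0 <= alpha k 0) ->
  exists x, optimal H alpha x.
Proof.
move=> alpha0.
pose box := [set v : 'rV[R]_nT |
  forall i, (`[0, alpha i 0]%classic : set R) (v 0 i)]%classic.
have boxP v : box v <-> feasible alpha v^T.
  by split => bv k; have := bv k; rewrite /= in_itv/= mxE.
have box_compact : compact box.
  apply: (rV_compact (A := fun i => `[0, alpha i 0]%classic)) => i.
  exact: segment_compact.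
have box_neq0 : (box !=set0)%classic.
  by exists 0; apply/boxP => k; rewrite !mxE lexx alpha0.
have [|v v_box v_min] :=
  @EVT_min_rV R nT (fun v => f0 H v^T) box box_neq0 box_compact.
  exact/continuous_subspaceT/continuous_f0_tr.
exists v^T; split; first exact/boxP/set_mem.
move=> y y_feas; rewrite -[y]trmxK; apply: v_min.
by apply/mem_set/boxP; rewrite trmxK.
Qed.

Hypotheses (G_ge0 : forall i j, 0 <= gram H i j)
           (G_diag_gt0 : forall k, 0 < gram H k k).

Lemma optimal_le_half x k : optimal H alpha x -> x k 0 <= 2^-1.
Proof.
move=> [x_feas x_min]; rewrite leNgt; apply/negP => xk.
pose y := \col_i Num.min (x i 0) 2^-1.
have /x_min : feasible alpha y.
  move=> i; have /andP[xi0 xi] := x_feas i; rewrite mxE le_min xi0 ge_min xi.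
  by rewrite invr_ge0 ler0n.
apply/negP; rewrite -ltNge; apply: (@f0_lt _ _ _ _ _ _ k) => // [i j|].
  have /andP[xi0 _] := x_feas i; have /andP[xj0 _] := x_feas j.
  by rewrite !mxE le_cov_min_half.
by rewrite mxE (min_r (ltW xk)); nra.
Qed.

(** The bound [m] stays free to serve both cases of the theorem: 1/2 and the smallest [alpha]. *)
Lemma optimal_ge x k m : (forall i, m <= alpha i 0) -> m <= 2^-1 ->
  optimal H alpha x -> m <= x k 0.
Proof.
move=> m_alpha m2 x_opt; have x2 i := optimal_le_half i x_opt.
case: x_opt => x_feas x_min; rewrite leNgt; apply/negP => xk.
pose y := \col_i Num.max (x i 0) m.
have /x_min : feasible alpha y.
  move=> i; have /andP[xi0 xi] := x_feas i.
  by rewrite mxE le_max xi0 ge_max xi m_alpha.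
apply/negP; rewrite -ltNge; apply: (@f0_lt _ _ _ _ _ _ k) => // [i j|].
  by rewrite !mxE le_cov_max.
(* Strict gain: [t * (1 - t)] is strictly increasing up to 1/2 and [x k 0 < m <= 2^-1]. *)
by rewrite mxE (max_r (ltW xk)); nra.
Qed.

End Optimal.

(* The number of columns n_T is n.+1: a nonzero matrix has at least one column;
   alpha_1 is alpha ord0 0 and alpha_{n_T} is alpha ord_max 0. *)
Theorem proposition5 (R : realType) (nR n : nat) (H : 'M[R]_(nR, n.+1))
    (alpha : 'cV[R]_n.+1)
    (H_ge0 : forall i j, 0 <= H i j)
    (H_neq0 : H != 0)
    (H_conn : strongly_connected (channel_edge H))
    (alpha01 : forall k, 0 <= alpha k 0 <= 1)
    (alpha_noninc : forall i j : 'I_n.+1, (i <= j)%N -> alpha j 0 <= alpha i 0) :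
  (exists x : 'cV[R]_n.+1, optimal H alpha x) /\
  forall x : 'cV[R]_n.+1, optimal H alpha x ->
    (2^-1 <= alpha ord_max 0 -> x = 2^-1 *: const_mx 1) /\
    (alpha ord_max 0 < 2^-1 ->
       forall k, alpha ord_max 0 <= x k 0 <= Num.min (alpha ord0 0) 2^-1).
Proof.
have G_ge0 i j := gram_ge0 i j H_ge0.
have G_diag_gt0 k : 0 < gram H k k.
  exact/gram_diag_gt0/strongly_connected_col_neq0.
have alpha_min k : alpha ord_max 0 <= alpha k 0.
  by apply: alpha_noninc; rewrite -ltnS ltn_ord.
split; first by apply: optimal_exists => k; have /andP[] := alpha01 k.
move=> x x_opt; have x_le k := optimal_le_half G_ge0 G_diag_gt0 k x_opt.
split=> [le_half|lt_half k].
  (* Upper and lower bounds meet at 1/2. *)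
  apply/colP => k; rewrite !mxE mulr1; apply/eqP; rewrite eq_le x_le/=.
  apply: optimal_ge x_opt => // i; exact: le_trans le_half _.
rewrite le_min x_le andbT; apply/andP; split.
  by apply: optimal_ge x_opt => //; exact: ltW.
have [/(_ k)/andP[_ xk] _] := x_opt.
by apply: le_trans xk _; apply: alpha_noninc; exact: leq0n.
Qed.
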